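(* Let $(S,d)$ be a compact metric space without isolated points, and let $T\colon C(S)\to C(S)$ be a bounded linear operator. If $T$ does not fix a copy of $C(S)$, then $T$ satisfies the Daugavet equation, i.e. $$\|\mathrm{Id}+T\| = 1+\|T\|.$$
   Context: Let $\mathbb{K}$ denote the scalar field, which may be either $\mathbb{R}$ or $\mathbb{C}$; the result is asserted in both cases. $C(S)$ is the Banach space of continuous $\mathbb{K}$-valued functions on $S$ with the sup norm, and $\mathrm{Id}$ is the identity operator. A bounded linear operator $T\colon X\to X$ on a Banach space $X$ fixes a copy of a Banach space $E$ if there is a (closed) linear subspace $F\subset X$ that is isomorphic to $E$ (linearly homeomorphic, not necessarily isometric) such that the restriction $T|_F$ is an into-isomorphism, i.e. there is $c>0$ with $\|Tf\|\ge c\|f\|$ for all $f\in F$. *)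

(* Defs.v *)
From HB Require Import structures.
From mathcomp Require Import all_boot all_order all_algebra.
From mathcomp Require Import all_classical all_reals all_analysis.
From mathcomp Require Import complex.

Set Implicit Arguments.
Unset Strict Implicit.
Unset Printing Implicit Defensive.

Import Order.TTheory GRing.Theory Num.Theory.
Import numFieldNormedType.Exports.

Local Open Scope classical_set_scope.
Local Open Scope ring_scope.

Variant scalars := RealScalars | ComplexScalars.

Definition scalarField (R : realType) (k : scalars) : numFieldType :=
  match k with
  | RealScalars => R
  | ComplexScalars => R[i]
  end.

(* Norms of a normedModType over K take their values in K.  [ofReal] and
   [modulus] translate between R and the nonnegative elements of K, which allows
   suprema to be taken in R. *)
Definition ofReal (R : realType) (k : scalars) : R -> scalarField R k :=
  match k return R -> scalarField R k with
  | RealScalars => fun x => x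
  | ComplexScalars => fun x => x%:C%C
  end.

Definition modulus (R : realType) (k : scalars) : scalarField R k -> R :=
  match k return scalarField R k -> R with
  | RealScalars => fun x => `|x|
  | ComplexScalars => fun z => Num.sqrt (complex.Re z ^+ 2 + complex.Im z ^+ 2)
  end.

Arguments ofReal {R} k x.
Arguments modulus {R k} x.

Section scalar_theory.
Context {R : realType} {k : scalars}.
Local Notation K := (scalarField R k).
Implicit Types (x y : K) (a b : R).

Lemma normE x : `|x| = ofReal k (modulus x).
Proof. by case: k x => //= -[]. Qed.

Lemma ofRealK a : 0 <= a -> modulus (ofReal k a) = a.
Proof.
case: k => /= a0; first by rewrite ger0_norm.
by rewrite expr0n addr0 sqrtr_sqr ger0_norm.
Qed.

Lemma ler_ofReal a b : (ofReal k a <= ofReal k b) = (a <= b).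
Proof. by case: k => //=; rewrite lecR. Qed.

Lemma ltr_ofReal a b : (ofReal k a < ofReal k b) = (a < b).
Proof. by case: k => //=; rewrite ltcR. Qed.

Lemma ofRealD a b : ofReal k (a + b) = ofReal k a + ofReal k b.
Proof. by case: k => //=; rewrite rmorphD. Qed.

Lemma ofRealM a b : ofReal k (a * b) = ofReal k a * ofReal k b.
Proof. by case: k => //=; rewrite rmorphM. Qed.

Lemma ofReal0 : ofReal k 0 = 0 :> K.
Proof. by case: k. Qed.

Lemma ofReal_inj : injective (ofReal k : R -> K).
Proof. by move=> a b ab; apply/eqP; rewrite eq_le -!ler_ofReal ab lexx. Qed.

Lemma modulus_ge0 x : 0 <= modulus x.
Proof. by rewrite -ler_ofReal -normE ofReal0. Qed.

Lemma modulusD x y : modulus (x + y) <= modulus x + modulus y.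
Proof. by rewrite -ler_ofReal ofRealD -!normE ler_normD. Qed.

Lemma modulusM x y : modulus (x * y) = modulus x * modulus y.
Proof. by apply: ofReal_inj; rewrite ofRealM -!normE normrM. Qed.

Lemma modulusN x : modulus (- x) = modulus x.
Proof. by apply: ofReal_inj; rewrite -!normE normrN. Qed.

Lemma modulus0 : modulus (0 : K) = 0.
Proof. by apply: ofReal_inj; rewrite -normE normr0 ofReal0. Qed.

Lemma modulus0_eq0 x : modulus x = 0 -> x = 0.
Proof. by move=> x0; apply/normr0_eq0; rewrite normE x0 ofReal0. Qed.

Lemma modulusB x y : `|modulus x - modulus y| <= modulus (x - y).
Proof.
rewrite ler_norml; apply/andP; split.
  rewrite lerNl opprB lerBlDr -[modulus (x - y)]modulusN opprB.
  by rewrite (le_trans _ (modulusD _ _))// subrK.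
by rewrite lerBlDr (le_trans _ (modulusD _ _))// subrK.
Qed.

Lemma modulus_continuous : continuous (modulus : K -> R).
Proof.
move=> x; apply/(@cvgrPdist_lt _ _ _ (nbhs x)) => e e0; near=> y.
rewrite (le_lt_trans (modulusB _ _))// -ltr_ofReal -normE.
near: y; apply: (@cvgr_dist_lt K K _ (nbhs x) (nbhs_filter x) id x); first exact: cvg_id.
by rewrite -ofReal0 ltr_ofReal.
Unshelve. all: by end_near. Qed.

End scalar_theory.

(* The Banach space C(S) over the scalar field [scalarField R k]: the library
   type [continuousType] of continuous functions, under a name of its own so that
   it carries the supremum norm below and no other topology. *)
Definition contSpace (R : realType) (S : topologicalType)
  (cS : compact [set: S]) (k : scalars) : Type :=
  continuousType S (scalarField R k).

Section contSpace_lmodule.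
Context {R : realType} {S : topologicalType} {cS : compact [set: S]}
  {k : scalars}.
Local Notation K := (scalarField R k).
Local Notation X := (@contSpace R S cS k).

HB.instance Definition _ := Choice.copy X (continuousType S K).

Definition csval (f : X) : S -> K := f.
Local Coercion csval : contSpace >-> Funclass.

Definition mkcs (f : S -> K) (cf : continuous f) : X :=
  [the continuousType S K of mkcts cf].

Lemma csP (f g : X) : csval f =1 csval g -> f = g.
Proof. by move=> fg; apply/continuousEP. Qed.

Lemma cs_continuous (f : X) : continuous (csval f).
Proof. exact: cts_fun. Qed.

Lemma cs0_continuous : continuous (fun _ : S => 0 : K).
Proof. by move=> s; exact: cvg_cst. Qed.

Lemma csN_continuous (f : X) : continuous (fun s => - f s).
Proof. by move=> s; apply: (@cvgN K K); exact: cs_continuous. Qed.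

Lemma csD_continuous (f g : X) : continuous (fun s => f s + g s).
Proof. by move=> s; apply: (@cvgD K K); exact: cs_continuous. Qed.

Lemma csZ_continuous (a : K) (f : X) : continuous (fun s => a * f s).
Proof.
by move=> s; apply: (@cvgM K); [exact: cvg_cst|exact: cs_continuous].
Qed.

Definition cs0 := mkcs cs0_continuous.
Definition csN f := mkcs (@csN_continuous f).
Definition csD f g := mkcs (@csD_continuous f g).
Definition csZ a f := mkcs (@csZ_continuous a f).

Lemma csDA : associative csD.
Proof. by move=> f g h; apply: csP => s; exact: addrA. Qed.

Lemma csDC : commutative csD.
Proof. by move=> f g; apply: csP => s; exact: addrC. Qed.

Lemma cs0D : left_id cs0 csD.
Proof. by move=> f; apply: csP => s; exact: add0r. Qed.

Lemma csND : left_inverse cs0 csN csD.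
Proof. by move=> f; apply: csP => s; exact: addNr. Qed.

HB.instance Definition _ := GRing.isZmodule.Build X csDA csDC cs0D csND.

Lemma csZA a b f : csZ a (csZ b f) = csZ (a * b) f.
Proof. by apply: csP => s; exact: mulrA. Qed.

Lemma cs1Z : left_id 1 csZ.
Proof. by move=> f; apply: csP => s; exact: mul1r. Qed.

Lemma csZDr : right_distributive csZ +%R.
Proof. by move=> a f g; apply: csP => s; exact: mulrDr. Qed.

Lemma csZDl f : {morph csZ^~ f : a b / a + b}.
Proof. by move=> a b; apply: csP => s; exact: mulrDl. Qed.

HB.instance Definition _ :=
  GRing.Zmodule_isLmodule.Build K X csZA cs1Z csZDr csZDl.

Definition supNorm (f : X) : R := sup (range (fun s => modulus (f s))).

Lemma modulus_has_ubound (f : X) : has_ubound (range (fun s => modulus (f s))).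
Proof.
have /compact_bounded[M [_ MA]] : compact (range (fun s => modulus (f s))).
  apply: continuous_compact => //; apply: continuous_subspaceT => s.
  apply: (@continuous_comp _ _ _ (csval f)); first exact: cs_continuous.
  exact: modulus_continuous.
exists (M + 1) => _ [s _ <-].
rewrite (le_trans (ler_norm _))//.
by apply: (MA (M + 1)); [rewrite ltrDl|exists s].
Qed.

Lemma modulus_le_supNorm (f : X) s : modulus (f s) <= supNorm f.
Proof. by apply: ub_le_sup; [exact: modulus_has_ubound|exists s]. Qed.

Lemma supNorm_le (f : X) (M : R) : 0 <= M ->
  (forall s, modulus (f s) <= M) -> supNorm f <= M.
Proof.
move=> M0 fM; rewrite /supNorm; set A := (X in sup X).
have [->|A0] := eqVneq A set0; first by rewrite sup0.
by apply: ge_sup; [exact/set0P|move=> _ [s _ <-]].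
Qed.

Lemma supNorm_ge0 (f : X) : 0 <= supNorm f.
Proof.
rewrite /supNorm; set A := (X in sup X).
have [->|/set0P[_ [s _ _]]] := eqVneq A set0; first by rewrite sup0.
exact: le_trans (modulus_ge0 _) (modulus_le_supNorm f s).
Qed.

Lemma supNormD (f g : X) : supNorm (f + g) <= supNorm f + supNorm g.
Proof.
apply: supNorm_le => [|s]; first by rewrite addr_ge0 ?supNorm_ge0.
by rewrite (le_trans (modulusD _ _))// lerD// modulus_le_supNorm.
Qed.

Lemma supNormZ_le (a : K) (f : X) : supNorm (a *: f) <= modulus a * supNorm f.
Proof.
apply: supNorm_le => [|s]; first by rewrite mulr_ge0 ?modulus_ge0 ?supNorm_ge0.
by rewrite modulusM ler_wpM2l ?modulus_ge0// modulus_le_supNorm.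
Qed.

Lemma supNormZ (a : K) (f : X) : supNorm (a *: f) = modulus a * supNorm f.
Proof.
apply/eqP; rewrite eq_le supNormZ_le/=.
have [->|a0] := eqVneq a 0; first by rewrite modulus0 mul0r supNorm_ge0.
have := supNormZ_le a^-1 (a *: f); rewrite scalerA mulVf// scale1r.
move=> /(ler_wpM2l (modulus_ge0 a))/le_trans; apply.
rewrite mulrA -modulusM divff//.
suff -> : modulus (1 : K) = 1 by rewrite mul1r.
by case: (k) => /=; rewrite ?normr1// expr1n expr0n addr0 sqrtr1.
Qed.

Lemma supNorm0_eq0 (f : X) : supNorm f = 0 -> f = 0.
Proof.
move=> f0; apply: csP => s; apply: modulus0_eq0; apply/eqP.
by rewrite eq_le modulus_ge0 andbT -f0 modulus_le_supNorm.
Qed.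

Let norm (f : X) : K := ofReal k (supNorm f).

Let norm_D f g : norm (f + g) <= norm f + norm g.
Proof. by rewrite -ofRealD ler_ofReal supNormD. Qed.

Let norm_Z (a : K) f : norm (a *: f) = `|a| * norm f.
Proof. by rewrite normE -ofRealM -supNormZ. Qed.

Let norm_eq0 f : norm f = 0 -> f = 0.
Proof. by rewrite /norm -ofReal0 => /ofReal_inj/supNorm0_eq0. Qed.

HB.instance Definition _ :=
  Lmodule_isNormed.Build K X norm_D norm_Z norm_eq0.

Lemma cs_normE (f : X) : `|f| = ofReal k (supNorm f).
Proof. by []. Qed.

End contSpace_lmodule.

Arguments contSpace R {S} cS k.

Definition opNorm (R : realType) (k : scalars)
    (X Y : normedModType (scalarField R k)) (T : X -> Y) : R :=
  sup [set modulus `|T x| | x in [set x : X | `|x| <= 1]].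

Arguments opNorm {R k X Y} T.

Definition closedSubspace (K : numFieldType) (X : normedModType K)
    (F : set X) : Prop :=
  [/\ closed F, F 0 & forall (a : K) (x y : X), F x -> F y -> F (a *: x + y)].

(* J is a linear homeomorphism from E onto F with inverse the restriction of G
   to F. *)
Definition isomorphicOnto (K : numFieldType) (E X : normedModType K)
    (F : set X) : Prop :=
  exists (J : {linear E -> X}) (G : X -> E),
    [/\ continuous J, range J = F, cancel J G & {within F, continuous G}].

Definition fixesCopy (K : numFieldType) (E X : normedModType K)
    (T : {linear X -> X}) : Prop :=
  exists F : set X,
    [/\ closedSubspace F, isomorphicOnto E F &
        exists2 c : K, 0 < c & forall f, F f -> c * `|f| <= `|T f| ].

Arguments fixesCopy {K} E {X} T.

(* Main.v *)
Require Import Defs.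
From HB Require Import structures.
From mathcomp Require Import all_boot all_order all_algebra.
From mathcomp Require Import all_classical all_reals all_analysis.
From mathcomp Require Import complex ring lra.

Set Implicit Arguments.
Unset Strict Implicit.
Unset Printing Implicit Defensive.

Import Order.TTheory GRing.Theory Num.Theory.
Import numFieldNormedType.Exports.

Local Open Scope classical_set_scope.
Local Open Scope ring_scope.

Local Coercion csval : contSpace >-> Funclass.

(** Write M for the norm of T and suppose that the norm of Id + T is at most
    1 + M - e with e > 0.  Choose f0 in the unit ball such that Re (T f0) is
    within eta of M on an open set U.  On U, the functional g |-> T g t is then
    almost normed by f0: if |g| <= b with b real-valued in [0, 1], then
    |T g t| <= Re (T (f0 b) t) + eta.  Testing Id + T on f0 + b (1 - f0), which
    lies in the unit ball, gives |T (b (1 - f0)) t| >= e - eta for t in U and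
    b t = 1: the measure representing g |-> T g t has a sizeable atom at t.
    The infimum of Re (T (f0 b) t) over t in U and over the b equal to 1 near t
    is almost attained by some (t0, h0).  On a neighbourhood W of t0 the pair
    (t, h0) is then almost optimal too, so that the measure of every t in W has
    almost no mass in W outside t.  Hence f |-> T ((1 - f0) f) is bounded below
    on the functions that vanish off W.

    It remains to embed C(S) into these functions.  Let phi map the Cantor space
    onto S.  Since S has no isolated point, W carries continuous functions
    u 0, u 1, ... with values in [0, 1] among whose values every finite 0-1
    pattern occurs.  Integrating f o phi against the product of the Bernoulli
    measures of parameters u 0 t, u 1 t, ... and multiplying by a cutoff is an
    isometric embedding. *)

(** * Scalars and spaces of continuous functions *)

Section scalars.
Context {R : realType} {k : scalars}.
Local Notation K := (scalarField R k).
Implicit Types (x y z : K) (a b e : R).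

Definition realPart : K -> R :=
  match k return scalarField R k -> R with
  | RealScalars => id
  | ComplexScalars => @complex.Re R
  end.

Lemma realPartD x y : realPart (x + y) = realPart x + realPart y.
Proof. by rewrite /realPart; case: k x y => //= -[? ?] [? ?]. Qed.

Lemma realPartB x y : realPart (x - y) = realPart x - realPart y.
Proof. by rewrite /realPart; case: k x y => //= -[? ?] [? ?]. Qed.

Lemma realPart_ofReal a : realPart (ofReal k a) = a.
Proof. by rewrite /realPart; case: k. Qed.

Lemma realPart_le_modulus x : `|realPart x| <= modulus x.
Proof.
rewrite /realPart; case: k x => //= -[u v] /=.
by rewrite -sqrtr_sqr ler_wsqrtr// lerDl sqr_ge0.
Qed.

Lemma modulus1 : modulus (1 : K) = 1.
Proof. by case: k => /=; rewrite ?normr1// expr1n expr0n addr0 sqrtr1. Qed.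

Lemma ofReal1 : ofReal k (1 : R) = 1 :> K.
Proof. by case: k. Qed.

Lemma realPart1 : realPart (1 : K) = 1.
Proof. by rewrite -ofReal1 realPart_ofReal. Qed.

Lemma ofRealN a : ofReal k (- a) = - ofReal k a :> K.
Proof. by case: k => //=; rewrite rmorphN. Qed.

Lemma ofRealB a b : ofReal k (a - b) = ofReal k a - ofReal k b :> K.
Proof. by rewrite ofRealD ofRealN. Qed.

Lemma modulus_ofReal a : modulus (ofReal k a) = `|a|.
Proof. by case: k => //=; rewrite expr0n addr0 sqrtr_sqr. Qed.

Lemma modulus_subC x y : modulus (x - y) = modulus (y - x).
Proof. by rewrite -modulusN opprB. Qed.

Lemma modulus_dist_triangle y x z :
  modulus (x - z) <= modulus (x - y) + modulus (y - z).
Proof. by rewrite (le_trans _ (modulusD _ _))// addrA subrK. Qed.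

Lemma unimodular_rotation x :
  exists2 u : K, modulus u = 1 & u * x = ofReal k (modulus x).
Proof.
have [->|x0] := eqVneq x 0.
  by exists 1; rewrite ?modulus1// mulr0 modulus0 ofReal0.
have mx0 : modulus x != 0 by apply: contra_neq x0 => /modulus0_eq0.
exists (ofReal k (modulus x) / x); last by rewrite divfK.
apply: (mulIf mx0); rewrite -modulusM divfK// mul1r.
by rewrite ofRealK ?modulus_ge0.
Qed.

(** A positive element of [K] is [ofReal] of its modulus, so real epsilons suffice and later
    estimates stay in [R]. *)
Lemma cvg_modulusP {T : Type} {F : set_system T} {FF : Filter F}
    (f : T -> K) (l : K) :
  f @ F --> l <-> forall e, 0 < e -> \forall t \near F, modulus (l - f t) < e.
Proof.
split=> [/(@cvgrPdist_lt K K _ F FF f l) fl e e0|fl].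
  have := fl (ofReal k e); rewrite -ofReal0 ltr_ofReal => /(_ e0).
  by apply: filterS => t; rewrite normE ltr_ofReal.
apply/(@cvgrPdist_lt K K _ F FF f l) => e e0.
have eE : e = ofReal k (modulus e) by rewrite -normE gtr0_norm.
move: e0; rewrite eE -ofReal0 ltr_ofReal => /fl.
by apply: filterS => t; rewrite normE ltr_ofReal.
Qed.

Lemma ofReal_continuous : continuous (ofReal k : R -> K).
Proof.
move=> a; apply/cvg_modulusP => e e0; near=> b.
rewrite -ofRealB modulus_ofReal; near: b.
exact: (@cvgr_dist_lt R R _ (nbhs a) (nbhs_filter a) id a (@cvg_id _ _)).
Unshelve. all: by end_near. Qed.

Lemma realPart_continuous : continuous (realPart : K -> R).
Proof.
move=> x; apply/(@cvgrPdist_lt R R _ (nbhs x)) => e e0; near=> y.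
rewrite -realPartB (le_lt_trans (realPart_le_modulus _))//.
near: y; move: e e0.
exact/(@cvg_modulusP _ (nbhs x) (nbhs_filter x) id x)/(@cvg_id _ _).
Unshelve. all: by end_near. Qed.

Lemma scalar_complete (x : nat -> K) :
  (forall e, 0 < e -> exists N, forall m n, (N <= m)%N -> (N <= n)%N ->
     modulus (x m - x n) <= e) ->
  exists l, forall e, 0 < e -> exists N, forall n, (N <= n)%N ->
     modulus (l - x n) <= e.
Proof.
have real_complete (u : nat -> R) :
    (forall e, 0 < e -> exists N, forall m n, (N <= m)%N -> (N <= n)%N ->
      `|u m - u n| <= e) ->
    exists l, forall e, 0 < e -> exists N, forall n, (N <= n)%N ->
      `|l - u n| <= e.
  move=> cu; have /cvg_ex[l ul] : cvg (u @ \oo).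
    apply/cauchy_cvgP/cauchy_exP => e e0.
    have [|N uN] := cu (e / 2); first by rewrite divr_gt0.
    exists (u N); exists N => // n /= Nn.
    rewrite /ball/= (le_lt_trans (uN _ _ _ Nn))//.
    by rewrite ltr_pdivrMr// ltr_pMr// ltr1n.
  exists l => e e0; move: ul => /cvgrPdist_le/(_ _ e0)[N _ lN].
  by exists N => n; exact: lN.
case: k x => [|x cx]; first exact: real_complete.
(* The complex case follows from the real one applied to the real and imaginary parts, each taken
   within [e / 2] of its limit. *)
have component (p : {additive R[i] -> R}) :
    (forall z : R[i], `|p z| <= modulus (z : scalarField R ComplexScalars)) ->
    exists l, forall e, 0 < e -> exists N, forall n, (N <= n)%N ->
      `|l - p (x n)| <= e.
  move=> pm; apply: real_complete => e /cx[N xN]; exists N => m n Nm Nn.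
  by rewrite -raddfB (le_trans (pm _))// xN.
have Re_le (z : R[i]) :
    `|complex.Re z| <= modulus (z : scalarField R ComplexScalars).
  by case: z => u v /=; rewrite -sqrtr_sqr ler_wsqrtr// lerDl sqr_ge0.
have Im_le (z : R[i]) :
    `|complex.Im z| <= modulus (z : scalarField R ComplexScalars).
  by case: z => u v /=; rewrite -sqrtr_sqr ler_wsqrtr// lerDr sqr_ge0.
have [a ax] := component (@complex.Re R) Re_le.
have [b bx] := component (@complex.Im R) Im_le.
exists (a +i* b)%C => e e0.
have e20 : 0 < e / 2 by rewrite divr_gt0.
have [N aN] := ax _ e20; have [M bM] := bx _ e20.
exists (maxn N M) => n; rewrite geq_max => /andP[/aN aNn /bM bMn] /=.
move: aNn bMn; case: (x n) => u v /= aNn bMn.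
rewrite -[leRHS]ger0_norm ?(ltW e0)// -sqrtr_sqr ler_wsqrtr//.
have : `|a - u| ^+ 2 <= (e / 2) ^+ 2 by rewrite lerXn2r ?nnegrE// ltW.
have : `|b - v| ^+ 2 <= (e / 2) ^+ 2 by rewrite lerXn2r ?nnegrE// ltW.
by rewrite !real_normK ?num_real//; nra.
Qed.
End scalars.

Section contSpace_theory.
Context {R : realType} {S : topologicalType} {cS : compact [set: S]}
  {k : scalars}.
Local Notation K := (scalarField R k).
Local Notation X := (contSpace R cS k).
Implicit Types (f g : X) (a : K) (s t : S).

Lemma csDE f g s : csval (f + g) s = f s + g s. Proof. by []. Qed.
Lemma csBE f g s : csval (f - g) s = f s - g s. Proof. by []. Qed.
Lemma csZE a f s : csval (a *: f) s = a * f s. Proof. by []. Qed.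
Lemma cs0E s : csval (0 : X) s = 0. Proof. by []. Qed.

Lemma csM_continuous f g : continuous (fun s => f s * g s).
Proof. by move=> s; apply: (@cvgM K); exact: cs_continuous. Qed.

Definition csM f g : X := mkcs (@csM_continuous f g).

Lemma csME f g s : csM f g s = f s * g s. Proof. by []. Qed.

Lemma csM_linear f : linear (csM f).
Proof.
by move=> a g h; apply: csP => s; rewrite csME csDE csZE mulrDr mulrCA.
Qed.

Definition csC a : X := mkcs (fun s => cvg_cst a : (fun=> a) @ nbhs s --> a).

Lemma csCE a s : csC a s = a. Proof. by []. Qed.

Lemma real_fun_continuous (r : S -> R) : continuous r ->
  continuous (fun s => ofReal k (r s)).
Proof.
by move=> cr s; apply: continuous_comp; [exact: cr|exact: ofReal_continuous].
Qed.

Definition csR (r : S -> R) (cr : continuous r) : X :=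
  mkcs (real_fun_continuous cr).

Lemma csRE (r : S -> R) (cr : continuous r) s : csR cr s = ofReal k (r s).
Proof. by []. Qed.

Lemma supNormN f : supNorm (- f) = supNorm f.
Proof. by rewrite -scaleN1r supNormZ modulusN modulus1 mul1r. Qed.

Lemma supNorm0 : supNorm (0 : X) = 0.
Proof. by rewrite -(scale0r (0 : X)) supNormZ modulus0 mul0r. Qed.

Lemma supNormM f g : supNorm (csM f g) <= supNorm f * supNorm g.
Proof.
apply: supNorm_le => [|s]; first by rewrite mulr_ge0 ?supNorm_ge0.
by rewrite csME modulusM ler_pM ?modulus_ge0 ?modulus_le_supNorm.
Qed.

Lemma supNorm_gt_ex f (a : R) (s0 : S) : a < supNorm f ->
  exists s, a < modulus (f s).
Proof.
move=> af; apply: contrapT => /forallNP fa.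
have a0 : 0 <= a.
  by rewrite (le_trans (modulus_ge0 (f s0)))// leNgt; apply/negP/fa.
move: af; rewrite ltNge => /negP; apply; apply: supNorm_le => // s.
by rewrite leNgt; apply/negP/fa.
Qed.

Lemma uniform_limit_continuous (h : S -> K) :
  (forall e : R, 0 < e -> exists f, forall s, modulus (h s - f s) <= e) ->
  continuous h.
Proof.
move=> hf s; apply/cvg_modulusP => e e0.
have [|f fh] := hf (e / 4); first by rewrite divr_gt0.
have /cvg_modulusP/(_ (e / 4)) := @cs_continuous _ _ _ _ f s.
rewrite divr_gt0// => /(_ isT); apply: filterS => t ft.
have h1 := modulus_dist_triangle (f s) (h s) (h t).
have h2 := modulus_dist_triangle (f t) (f s) (h t).
have := fh s; have := fh t; rewrite modulus_subC => h3 h4.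
by lra.
Qed.

Lemma contSpace_complete (x : nat -> X) :
  (forall e, 0 < e -> exists N, forall m n, (N <= m)%N -> (N <= n)%N ->
     supNorm (x m - x n) <= e) ->
  exists l : X, forall e, 0 < e -> exists N, forall n, (N <= n)%N ->
     supNorm (l - x n) <= e.
Proof.
move=> cx.
have pt s : exists l : K, forall e : R, 0 < e ->
    exists N, forall n, (N <= n)%N -> modulus (l - x n s) <= e.
  apply: scalar_complete => e /cx[N xN]; exists N => m n Nm Nn.
  by rewrite (le_trans _ (xN _ _ Nm Nn))// -csBE modulus_le_supNorm.
pose h s := projT1 (cid (pt s)).
have hx s : forall e : R, 0 < e -> exists N, forall n, (N <= n)%N ->
    modulus (h s - x n s) <= e.
  by rewrite /h; case: cid.
have unif e : 0 < e -> exists N, forall n, (N <= n)%N ->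
    forall s, modulus (h s - x n s) <= e.
  move=> e0; have [N xN] := cx _ e0; exists N => n Nn s.
  (* [M] depends on [s] but enters only through the intermediate index [maxn N M]; the index [N] is
     uniform in [s]. *)
  apply/ler_addgt0Pr => d d0; have [M hM] := hx s _ d0.
  rewrite (le_trans (modulus_dist_triangle (x (maxn M N) s) _ _))// addrC.
  apply: lerD; last by rewrite hM ?leq_maxl.
  rewrite -csBE (le_trans (modulus_le_supNorm _ _))// xN// leq_maxr.
  by [].
have ch : continuous h.
  apply: uniform_limit_continuous => e /unif[N hN].
  by exists (x N) => s; exact: hN.
exists (mkcs ch) => e e0; have [N hN] := unif _ e0; exists N => n Nn.
by apply: supNorm_le => [|s]; [exact: ltW|exact: hN].
Qed.

Lemma norm_le_supNorm f (a : R) : (`|f| <= ofReal k a) = (supNorm f <= a).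
Proof. by rewrite cs_normE ler_ofReal. Qed.

Lemma supNorm_bounded_continuous (J : {linear X -> X}) (C : R) :
  (forall f, supNorm (J f) <= C * supNorm f) -> continuous J.
Proof.
move=> JC; apply/linear_bounded_continuous/ex_bound.
exists (ofReal k `|C|); apply/nbhs_norm0P; exists 1 => //= f /=.
rewrite -ofReal1 cs_normE ltr_ofReal => f1.
rewrite norm_le_supNorm (le_trans (JC _))//.
rewrite (le_trans (ler_wpM2r (supNorm_ge0 _) (ler_norm _)))//.
by rewrite ler_piMr// ltW.
Qed.

Lemma supNorm_closure (F : set X) f : closure F f ->
  forall e : R, 0 < e -> exists2 g, F g & supNorm (f - g) < e.
Proof.
move=> Ff e e0; have /Ff : nbhs f [set g | supNorm (f - g) < e].
  apply/nbhs_normP; exists (ofReal k e).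
    by rewrite /= -ofReal0 ltr_ofReal.
  by move=> g; rewrite /= cs_normE ltr_ofReal.
by move=> [g [Fg fg]]; exists g.
Qed.

(** The copy is [range J]. As [T] is bounded, a lower bound for [T \o J] yields one for [J]: hence
    [J] is injective, its inverse is continuous on the range, and the range is closed by
    completeness of C(S). *)
Lemma fixesCopy_of_lower_bound (T J : {linear X -> X}) (C D c : R) :
  (forall f, supNorm (J f) <= C * supNorm f) ->
  (forall f, supNorm (T f) <= D * supNorm f) ->
  0 < c -> (forall f, c * supNorm f <= supNorm (T (J f))) ->
  fixesCopy X T.
Proof.
move=> JC TD c0 TJc.
(* [C] and [D] carry no sign; they are enlarged to positive constants by which one may divide. *)
have [D1 D10 TD1] : exists2 D1, 0 < D1 &
    forall f, supNorm (T f) <= D1 * supNorm f.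
  exists (`|D| + 1) => [|f]; first by rewrite ltr_wpDl.
  rewrite (le_trans (TD f))// ler_wpM2r ?supNorm_ge0//.
  by rewrite (le_trans (ler_norm _))// lerDl.
have [C1 C10 JC1] : exists2 C1, 0 < C1 &
    forall f, supNorm (J f) <= C1 * supNorm f.
  exists (`|C| + 1) => [|f]; first by rewrite ltr_wpDl.
  rewrite (le_trans (JC f))// ler_wpM2r ?supNorm_ge0//.
  by rewrite (le_trans (ler_norm _))// lerDl.
have Jc f : supNorm f <= D1 / c * supNorm (J f).
  rewrite mulrAC ler_pdivlMr// mulrC.
  exact: le_trans (TJc f) (TD1 _).
have Dc0 : 0 < D1 / c by rewrite divr_gt0.
have Jinj : injective J.
  move=> f g fg; apply/eqP; rewrite -subr_eq0; apply/eqP/supNorm0_eq0.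
  apply/eqP; rewrite eq_le supNorm_ge0 andbT (le_trans (Jc _))//.
  by rewrite linearB fg subrr supNorm0 mulr0.
have [G JK] : exists G : X -> X, cancel J G.
  (* Off the range of [J] the left inverse takes the default value 0. *)
  exists (fun y => if pselect (exists x, J x = y) is left e
            then projT1 (cid e) else 0) => x.
  case: pselect => [e|]; last by case; exists x.
  by case: cid => y /= /Jinj.
exists (range J); split.
- split.
  (* Preimages of points of the range tending to [y] form a Cauchy sequence, and [J] sends its limit
     to [y]. *)
  + move=> y /supNorm_closure yJ.
    have xP n : exists x, supNorm (y - J x) < n.+1%:R^-1.
      by have [|_ [x _ <-] xy] := yJ n.+1%:R^-1; [rewrite invr_gt0|exists x].
    pose x n := projT1 (cid (xP n)).
    have xy n : supNorm (y - J (x n)) < n.+1%:R^-1 by rewrite /x; case: cid.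
    have small e : 0 < e -> exists N, forall n, (N <= n)%N ->
        supNorm (y - J (x n)) <= e.
      move=> e0; have [N Ne] := ltr_add_invr e0.
      exists N => n Nn; rewrite (le_trans (ltW (xy n)))//.
      rewrite add0r in Ne; rewrite (le_trans _ (ltW Ne))//.
      by rewrite lef_pV2 ?posrE ?ltr0Sn// ler_nat.
    have [e e0|l lx] := @contSpace_complete x.
      have [|N xN] := small (e / (D1 / c) / 2); first by rewrite !divr_gt0.
      exists N => m n /xN Nm /xN Nn; rewrite (le_trans (Jc _))//.
      rewrite mulrC -ler_pdivlMr// linearB.
      have -> : J (x m) - J (x n) = - (y - J (x m)) + (y - J (x n)).
        by rewrite opprB addrA subrK.
      rewrite (le_trans (supNormD _ _))// supNormN.
      by rewrite (le_trans (lerD Nm Nn))// -splitr.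
    exists l => //; apply/eqP; rewrite eq_sym -subr_eq0; apply/eqP/supNorm0_eq0.
    apply/eqP; rewrite eq_le supNorm_ge0 andbT; apply/ler_addgt0Pr => e e0.
    rewrite add0r.
    have [|N xN] := small (e / 2); first by rewrite divr_gt0.
    have [|M xM] := lx (e / 2 / C1); first by rewrite !divr_gt0.
    have -> : y - J l = (y - J (x (maxn N M))) - J (l - x (maxn N M)).
      by rewrite linearB opprB addrA subrK.
    rewrite (le_trans (supNormD _ _))// supNormN [leRHS]splitr.
    apply: lerD; first by rewrite xN// leq_maxl.
    rewrite (le_trans (JC1 _))// mulrC -ler_pdivlMr// xM// leq_maxr.
    by [].
  + by exists 0 => //; rewrite linear0.
  + by move=> a _ _ [x _ <-] [y _ <-]; exists (a *: x + y); rewrite ?linearP.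
- exists J, G; split => //; first exact: supNorm_bounded_continuous JC.
  apply/subspace_continuousP => _ [f _ <-].
  apply/(@cvgrPdist_le K X _ (within (range J) (nbhs (J f)))) => e e0.
  have eE : e = ofReal k (modulus e) by rewrite -normE gtr0_norm.
  move: e0; rewrite eE -ofReal0 ltr_ofReal; move: (modulus e) => {eE}d d0.
  apply/nbhs_normP; exists (ofReal k (d / (D1 / c))).
    by rewrite /= -ofReal0 ltr_ofReal divr_gt0.
  move=> /= y + [g _ gy]; rewrite -gy /from_subspace !JK -linearB !cs_normE.
  rewrite ltr_ofReal ler_ofReal ltr_pdivlMr// mulrC => fg.
  by rewrite (le_trans (Jc _))// ltW.
- exists (ofReal k (c / C1)); first by rewrite -ofReal0 ltr_ofReal divr_gt0.
  move=> _ [f _ <-]; rewrite !cs_normE -ofRealM ler_ofReal.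
  rewrite (le_trans _ (TJc f))// mulrAC ler_pdivrMr// -mulrA ler_pM2l// mulrC.
  exact: JC1.
Qed.
End contSpace_theory.

(** * Localizing a failure of the Daugavet equation *)

Section clamp.
Context {R : realType}.

Definition clamp (x : R) : R := Num.max 0 (Num.min 1 x).

Lemma clamp_ge0 x : 0 <= clamp x.
Proof. by rewrite le_max lexx. Qed.

Lemma clamp_le1 x : clamp x <= 1.
Proof. by rewrite ge_max ler01 ge_min lexx. Qed.

Lemma clamp_eq0 x : x <= 0 -> clamp x = 0.
Proof. by move=> x0; apply/max_idPl; rewrite ge_min x0 orbT. Qed.

Lemma clamp_eq1 x : 1 <= x -> clamp x = 1.
Proof. by move=> x1; rewrite /clamp (min_idPl x1) (max_idPr ler01). Qed.

Lemma clamp_continuous {T : topologicalType} (r : T -> R) :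
  continuous r -> continuous (clamp \o r).
Proof.
move=> cr t.
apply: (@continuous_max _ _ (cst 0) ((cst 1) \min r)); first exact: cvg_cst.
by apply: continuous_min; [exact: cvg_cst|exact: cr].
Qed.
End clamp.

Section daugavet.
Context {R : realType} {S : topologicalType} {cS : compact [set: S]}
  {k : scalars}.
Local Notation K := (scalarField R k).
Local Notation X := (contSpace R cS k).
Implicit Types (f g b : X) (a : K) (s t : S).

(** Real values in [0, 1], expressed for both scalar fields at once: a scalar equal to its modulus
    is real and nonnegative. *)
Definition unitval b := forall s,
  b s = ofReal k (modulus (b s)) /\ modulus (b s) <= 1.

Lemma unitval_csR (r : S -> R) (cr : continuous r) :
  (forall s, 0 <= r s <= 1) -> unitval (csR cr).
Proof.
by move=> r01 s; have /andP[r0 r1] := r01 s; rewrite csRE ofRealK.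
Qed.

Lemma unitval1 : unitval (csC 1).
Proof. by move=> s; rewrite csCE modulus1 ofReal1. Qed.

Lemma unitvalM b b' : unitval b -> unitval b' -> unitval (csM b b').
Proof.
move=> ub ub' s; have [bE b1] := ub s; have [b'E b'1] := ub' s.
rewrite csME modulusM ofRealM -bE -b'E; split => //.
by rewrite mulr_ile1 ?modulus_ge0.
Qed.

Lemma modulus_unitvalC b s : unitval b ->
  modulus (1 - b s) = 1 - modulus (b s).
Proof.
move=> /(_ s)[bE b1]; rewrite {1}bE -ofReal1 -ofRealB.
by rewrite ofRealK// subr_ge0.
Qed.

Lemma unitvalC b : unitval b -> unitval (csC 1 - b).
Proof.
move=> ub s; have [bE b1] := ub s; rewrite csBE csCE modulus_unitvalC//.
by rewrite ofRealB ofReal1 -bE lerBlDr lerDl modulus_ge0.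
Qed.

(** The bump is a function of |f - f s|, supported where this is at most [d]; replacing [f] by the
    constant [f s] under the bump thus costs at most [d]. *)
Lemma unitval_bump f s (d : R) : 0 < d -> exists b, [/\ unitval b,
  \forall t \near s, b t = 1 &
  forall t, modulus (b t * (f t - f s)) <= d].
Proof.
(* [r] is at least 1 where |f - f s| <= d / 2 and at most 0 where |f - f s| >= d. *)
move=> d0; pose r t := 2 - 2 / d * modulus (f t - f s).
have cr : continuous r.
  move=> t; apply: cvgB; first exact: cvg_cst.
  apply: cvgM; first exact: cvg_cst.
  apply: (continuous_comp (f := fun t => f t - f s)).
    by apply: (@cvgB K K); [exact: cs_continuous|exact: cvg_cst].
  exact: modulus_continuous.
exists (csR (clamp_continuous cr)); split.
- by apply: unitval_csR => t; rewrite /= clamp_ge0 clamp_le1.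
- have /cvg_modulusP/(_ (d / 2)) := @cs_continuous _ _ _ _ f s.
  rewrite divr_gt0// => /(_ isT); apply: filterS => t ft.
  rewrite csRE /= clamp_eq1 ?ofReal1// /r modulus_subC.
  have : 2 / d * modulus (f s - f t) <= 2 / d * (d / 2).
    by rewrite ler_pM2l ?divr_gt0// ltW.
  have -> : 2 / d * (d / 2) = 1 by field; rewrite gt_eqF.
  by move=> ?; lra.
- move=> t; rewrite csRE modulusM ofRealK ?clamp_ge0//=.
  have [fd|/ltW fd] := leP (modulus (f t - f s)) d.
    by rewrite (le_trans _ fd)// ler_piMl ?modulus_ge0 ?clamp_le1.
  rewrite clamp_eq0; first by rewrite mul0r ltW.
  rewrite /r subr_le0 mulrAC ler_pdivlMr//.
  by rewrite ler_pM2l.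
Qed.

Context (T : {linear X -> X}) (M e : R) (e0 : 0 < e)
  (TM : forall f, supNorm f <= 1 -> supNorm (T f) <= M)
  (M_approx : forall eta : R, 0 < eta ->
    exists2 f, supNorm f <= 1 & M - eta < supNorm (T f))
  (gap : forall f, supNorm f <= 1 -> supNorm (f + T f) <= 1 + M - e).

Lemma T_le_supNorm f : supNorm (T f) <= M * supNorm f.
Proof.
have [f0|f0] := eqVneq (supNorm f) 0.
  by rewrite f0 mulr0 (supNorm0_eq0 f0) linear0 supNorm0.
have fp : 0 < supNorm f by rewrite lt_neqAle eq_sym f0 supNorm_ge0.
have := TM (f := ofReal k (supNorm f)^-1 *: f).
rewrite linearZ !supNormZ modulus_ofReal ger0_norm ?invr_ge0 ?supNorm_ge0//.
by rewrite mulVf// lexx => /(_ isT); rewrite mulrC ler_pdivrMr.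
Qed.

Section near_norming.
Context (eta : R) (f0 : X) (U : set S) (f01 : supNorm f0 <= 1)
  (Uf0 : forall t, U t -> M - eta < realPart (csval (T f0) t)).

(* [weight t b] is, up to [eta], the integral of [b] against the variation of
   the measure representing the functional [f |-> T f t]. *)
Definition weight t b : R := realPart (csval (T (csM f0 b)) t).

Lemma weightD t b b' : weight t (b + b') = weight t b + weight t b'.
Proof.
rewrite /weight -realPartD -csDE -linearD; congr (realPart (csval (T _) t)).
by apply: csP => s; rewrite csME !csDE mulrDr.
Qed.

(** Let [u] rotate [T g t] onto the nonnegative half-line. Since |g| <= b, the function
    [u g + f0 (1 - b)] lies in the unit ball, so |T g t| + Re (T f0 t) - weight t b <= M, while Re
    (T f0 t) > M - eta. *)
Lemma modulus_le_weight t b g : U t -> unitval b ->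
  (forall s, modulus (g s) <= modulus (b s)) ->
  modulus (csval (T g) t) <= weight t b + eta.
Proof.
move=> Ut ub gb; have [u u1 uT] := unimodular_rotation (csval (T g) t).
pose h := u *: g + csM f0 (csC 1 - b).
have h1 : supNorm h <= 1.
  apply: supNorm_le => // s; have [_ b1] := ub s.
  rewrite /h csDE csZE csME csBE csCE (le_trans (modulusD _ _))// !modulusM.
  rewrite u1 mul1r modulus_unitvalC//.
  have := gb s; have := le_trans (modulus_le_supNorm f0 s) f01.
  have := modulus_ge0 (f0 s) => *; nra.
have := le_trans (modulus_le_supNorm (T h) t) (TM h1).
have hT : realPart (csval (T h) t) =
    modulus (csval (T g) t) + (realPart (csval (T f0) t) - weight t b).
  rewrite /h linearD linearZ csDE csZE uT realPartD realPart_ofReal.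
  congr (_ + _); rewrite /weight -realPartB -csBE -linearB.
  congr (realPart (csval (T _) t)); apply: csP => s.
  by rewrite csME !csBE csCE csME mulrBr mulr1.
have := le_trans (ler_norm _) (realPart_le_modulus (csval (T h) t)).
by rewrite hT; have := Uf0 Ut; move=> *; lra.
Qed.

Lemma modulus_le_weightM t b g (L : R) : 0 <= L -> U t -> unitval b ->
  (forall s, modulus (g s) <= L * modulus (b s)) ->
  modulus (csval (T g) t) <= L * (weight t b + eta).
Proof.
move=> L0 Ut ub gb; have [L_0|Ln0] := eqVneq L 0.
  rewrite L_0 mul0r; suff -> : g = 0 by rewrite linear0 modulus0.
  apply: csP => s; apply: modulus0_eq0; apply/eqP.
  by rewrite eq_le modulus_ge0 andbT (le_trans (gb s))// L_0 mul0r.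
have Lp : 0 < L by rewrite lt_neqAle eq_sym Ln0.
have LK : modulus (ofReal k L^-1) = L^-1.
  by rewrite modulus_ofReal ger0_norm ?invr_ge0.
have := modulus_le_weight (g := ofReal k L^-1 *: g) Ut ub.
rewrite linearZ csZE modulusM LK mulrC ler_pdivrMr// mulrC; apply => s.
by rewrite csZE modulusM LK mulrC ler_pdivrMr// mulrC.
Qed.

(** The case g = 0 of the previous bound; it makes the infimum of the weights finite. *)
Lemma weight_ge t b : U t -> unitval b -> - eta <= weight t b.
Proof.
move=> Ut ub; have : modulus (csval (T 0) t) <= weight t b + eta.
  by apply: modulus_le_weight => // s; rewrite cs0E modulus0 modulus_ge0.
by rewrite linear0 cs0E modulus0 -lerBlDr sub0r.
Qed.

Lemma weight_continuous b : continuous (weight^~ b).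
Proof.
move=> t; apply: (continuous_comp (f := csval (T (csM f0 b)))).
  exact: cs_continuous.
exact: realPart_continuous.
Qed.

(** The test function f0 + b (1 - f0) = (1 - b) f0 + b lies in the unit ball and equals 1 at [t]. So
    |1 + T f0 t + T w t| <= 1 + M - e, whereas |1 + T f0 t| > 1 + M - eta. *)
Lemma diagonal_mass t b : U t -> unitval b -> b t = 1 ->
  e - eta <= modulus (csval (T (csM b (csC 1 - f0))) t).
Proof.
move=> Ut ub bt; set w := csM b _.
have h1 : supNorm (f0 + w) <= 1.
  apply: supNorm_le => // s; have [bE b1] := ub s.
  have -> : csval (f0 + w) s = (1 - b s) * f0 s + b s.
    rewrite /w csDE csME csBE csCE.
    by ring.
  rewrite (le_trans (modulusD _ _))// modulusM modulus_unitvalC//.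
  have := le_trans (modulus_le_supNorm f0 s) f01; have := modulus_ge0 (f0 s).
  by move=> *; nra.
have := le_trans (modulus_le_supNorm _ t) (gap h1).
have -> : csval (f0 + w + T (f0 + w)) t =
    1 + csval (T f0) t + csval (T w) t.
  by rewrite linearD !csDE csME csBE csCE bt; ring.
move=> h2.
have : 1 + realPart (csval (T f0) t) <= modulus (1 + csval (T f0) t).
  rewrite (le_trans _ (realPart_le_modulus _))// realPartD.
  by rewrite realPart1 ler_norm.
have : modulus (1 + csval (T f0) t) <=
    modulus (1 + csval (T f0) t + csval (T w) t) + modulus (csval (T w) t).
  have := modulusD (1 + csval (T f0) t + csval (T w) t) (- csval (T w) t).
  by rewrite addrK modulusN.
by have := Uf0 Ut; move: h2; move=> *; lra.
Qed.
End near_norming.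

(** Take q = 1 - f0. For [t] in [W] and a bump [b] at [t], split q f into f(t) b q, q (1 - b) f and
    q b (f - f(t)). At [t], [T] of the first has modulus at least (e - eta) |f t| by
    [diagonal_mass]; the second is controlled by the small weight of h0 (1 - b), the third by the
    choice of the bump. *)
Lemma local_lower_bound (s0 : S) : exists (q : X) (W : set S),
  [/\ supNorm q <= 2, open W, W !=set0 &
    forall f, (forall s, ~ W s -> f s = 0) ->
      e / 2 * supNorm f <= supNorm (T (csM q f))].
Proof.
(* The errors below add up to 5 eta |f|, and e - 5 eta = e / 2. *)
pose eta : R := e / 10; have eta0 : 0 < eta by rewrite divr_gt0.
have [f1 f11 /(supNorm_gt_ex s0)[t1 ft1]] := M_approx eta0.
have [u u1 uT] := unimodular_rotation (csval (T f1) t1).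
pose f0 := u *: f1.
have f01 : supNorm f0 <= 1 by rewrite supNormZ u1 mul1r.
pose U := [set t | M - eta < realPart (csval (T f0) t)].
have Ut1 : U t1.
  have f0t1 : csval (T f0) t1 = ofReal k (modulus (csval (T f1) t1)).
    by rewrite /f0 linearZ csZE uT.
  by rewrite /U /= f0t1 realPart_ofReal.
have oU : open U.
  apply: (@open_comp _ _ (fun t => realPart (csval (T f0) t))
    [set x | M - eta < x]).
    move=> t _; apply: (continuous_comp (f := csval (T f0))).
      exact: cs_continuous.
    exact: realPart_continuous.
  exact: open_gt.
have Uf0 t : U t -> M - eta < realPart (csval (T f0) t) by [].
pose P := [set x | exists t b,
  [/\ U t, unitval b, \forall s \near t, b s = 1 & x = weight f0 t b]].
have P_inf : has_inf P.
  split.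
    exists (weight f0 t1 (csC 1)), t1, (csC 1); split => //.
      exact: unitval1.
    exact: nearW.
  exists (- eta) => _ [t [b [Ut ub _ ->]]].
  exact: weight_ge f01 Uf0 _ _ Ut ub.
(* Since t0 and h0 almost minimize the weight over the functions equal to 1 near
   a point of U, cutting h0 down near a point t of W loses little weight: the
   functional at t has almost no mass in W away from t. *)
have [_ [t0 [h0 [Ut0 uh0 h01 ->]]] ht0] := inf_adherent eta0 P_inf.
pose W := U `&` [set t | weight f0 t h0 < inf P + eta] `&`
  [set s | h0 s = 1]^°.
exists (csC 1 - f0), W; split.
- rewrite (le_trans (supNormD _ _))// supNormN lerD//.
  by apply: supNorm_le => // s; rewrite csCE modulus1.
- apply: openI; last exact: open_interior.
  apply: openI => //.
  apply: (@open_comp _ _ (weight f0 ^~ h0) [set x | x < inf P + eta]).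
    by move=> t _; exact: weight_continuous.
  exact: open_lt.
- by exists t0; split.
move=> f fW; set q := csC 1 - f0.
have q2 s : modulus (csval q s) <= 2.
  rewrite /q csBE csCE (le_trans (modulusD _ _))// modulus1 modulusN lerD//.
  exact: le_trans (modulus_le_supNorm f0 s) f01.
set N := supNorm (T (csM q f)).
have eeta : 0 < e - eta by rewrite subr_gt0 ltr_pdivrMr// ltr_pMr// ltr1n.
suff : supNorm f <= (N + 4 * eta * supNorm f) / (e - eta).
  by rewrite ler_pdivlMr// /eta; lra.
have M0 : 0 <= M.
  rewrite (le_trans (supNorm_ge0 (T 0)))// TM// supNorm0.
  by [].
have rhs0 : 0 <= N + 4 * eta * supNorm f.
  by rewrite addr_ge0 ?mulr_ge0 ?supNorm_ge0 ?ltW.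
apply: supNorm_le => [|t]; first by rewrite divr_ge0// ltW.
have [Wt|/fW ->] := pselect (W t); last by rewrite modulus0 divr_ge0// ltW.
rewrite ler_pdivlMr//; apply/ler_addgt0Pr => d d0.
(* The third term has norm at most 2 th before [T] and 2 M th <= d after it; the summand 1 covers
   the case M = 0. *)
pose th := d / (2 * M + 1).
have th0 : 0 < th by rewrite divr_gt0// ltr_wpDl// mulr_ge0.
have [b [ub bt bf]] := unitval_bump f t th0.
case: (Wt) => -[Ut Wt2 Wt3].
have bt1 : b t = 1 := nbhs_singleton bt.
have hb1 : \forall s \near t, csM h0 b s = 1.
  near=> s; rewrite csME (near bt s)// mulr1.
  by near: s; exact: Wt3.
(* [h0 b] is still 1 near [t], so its weight is at least [inf P]; that of [h0] is below
   [inf P + eta], and weights are additive. *)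
have w1 : weight f0 t (csM h0 (csC 1 - b)) <= eta.
  have : inf P <= weight f0 t (csM h0 b).
    apply: ge_inf; first by case: P_inf.
    by exists t, (csM h0 b); split => //; exact: unitvalM.
  have : weight f0 t h0 =
      weight f0 t (csM h0 b) + weight f0 t (csM h0 (csC 1 - b)).
    rewrite -weightD; congr (weight _ _ _); apply: csP => s.
    by rewrite csDE !csME csBE csCE; ring.
  by move: Wt2 => /= *; lra.
have part1 : modulus (csval (T (csM q (csM (csC 1 - b) f))) t) <=
    2 * supNorm f * (eta + eta).
  have uhb := unitvalM uh0 (unitvalC ub).
  apply: (le_trans (modulus_le_weightM f01 Uf0 (b := csM h0 (csC 1 - b))
    (L := 2 * supNorm f) _ Ut uhb _)).
  - by rewrite mulr_ge0 ?supNorm_ge0.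
  - move=> s; rewrite !csME !modulusM.
    (* [f] vanishes off [W] and [h0] is 1 on [W], so h0 (1 - b) dominates (1 - b) f up to the factor
       |f|. *)
    have [Ws|/fW ->] := pselect (W s); last first.
      by rewrite modulus0 !mulr0 !mulr_ge0 ?supNorm_ge0 ?modulus_ge0.
    have -> : h0 s = 1 by case: Ws => _ /interior_subset.
    rewrite modulus1 mul1r mulrCA mulrC ler_wpM2r ?modulus_ge0//.
    by rewrite ler_pM ?modulus_ge0 ?modulus_le_supNorm.
  - by rewrite ler_wpM2l ?lerD// mulr_ge0 ?supNorm_ge0.
have part2 : modulus (csval (T (csM q (csM b (f - csC (f t))))) t) <= d.
  rewrite (le_trans (modulus_le_supNorm _ _))//.
  rewrite (le_trans (T_le_supNorm _))//.
  have : supNorm (csM q (csM b (f - csC (f t)))) <= 2 * th.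
    apply: supNorm_le => [|s]; first by rewrite mulr_ge0 ?ltW.
    by rewrite csME modulusM; apply: ler_pM (q2 s) (bf s); exact: modulus_ge0.
  move=> /(ler_wpM2l M0)/le_trans; apply.
  rewrite /th mulrA mulrA ler_pdivrMr; last by rewrite ltr_wpDl// mulr_ge0.
  by lra.
have main := diagonal_mass f01 Uf0 Ut ub bt1.
have Teq : csM q f = f t *: csM b q + csM q (csM (csC 1 - b) f) +
    csM q (csM b (f - csC (f t))).
  by apply: csP => s; rewrite !csDE csZE !csME csBE csBE csCE csCE; ring.
have : modulus (csval (T (f t *: csM b q)) t) <= N +
    2 * supNorm f * (eta + eta) + d.
  have -> : csval (T (f t *: csM b q)) t = csval (T (csM q f)) t +
      (- csval (T (csM q (csM (csC 1 - b) f))) t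
       - csval (T (csM q (csM b (f - csC (f t))))) t).
    by rewrite Teq !linearD !csDE; ring.
  rewrite (le_trans (modulusD _ _))// -addrA lerD ?modulus_le_supNorm//.
  by rewrite (le_trans (modulusD _ _))// !modulusN lerD.
rewrite linearZ csZE modulusM => h.
have := ler_wpM2l (modulus_ge0 (f t)) main.
by move: h => *; lra.
Unshelve. all: by end_near. Qed.
End daugavet.

(** * Isometric copies of C(S) supported in an open set *)

Section bernoulli_mean.
Context {R : realType} {k : scalars}.
Local Notation K := (scalarField R k).
Implicit Types (x y : nat -> bool) (F G : (nat -> bool) -> K) (u : nat -> R).

(** The two inverse branches of the usual shift on the Cantor space. *)
Definition shift (b : bool) x (i : nat) : bool := if i is j.+1 then x j else b.

(* The integral of F against the product of the Bernoulli measures of parameters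
   u 0, ..., u (n - 1), all coordinates from n on being false. *)
Fixpoint bernoulli_mean n u F : K :=
  if n is m.+1 then
    ofReal k (1 - u 0%N) * bernoulli_mean m (u \o S) (F \o shift false) +
    ofReal k (u 0%N) * bernoulli_mean m (u \o S) (F \o shift true)
  else F (fun=> false).

Lemma bernoulli_mean_linear n u (a : K) F G :
  bernoulli_mean n u (fun x => a * F x + G x) =
  a * bernoulli_mean n u F + bernoulli_mean n u G.
Proof.
elim: n u F G => //= n IH u F G.
rewrite (IH _ (F \o shift false) (G \o shift false)).
rewrite (IH _ (F \o shift true) (G \o shift true)); ring.
Qed.

Lemma convex_near (c a b : K) (p d : R) : 0 <= p <= 1 ->
  modulus (c - a) <= d -> modulus (c - b) <= d ->
  modulus (c - (ofReal k (1 - p) * a + ofReal k p * b)) <= d.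
Proof.
move=> /andP[p0 p1] ca cb.
have -> : c - (ofReal k (1 - p) * a + ofReal k p * b) =
    ofReal k (1 - p) * (c - a) + ofReal k p * (c - b).
  by rewrite ofRealB ofReal1; ring.
rewrite (le_trans (modulusD _ _))// !modulusM !ofRealK ?subr_ge0//.
by rewrite -subr_ge0 in p1; nra.
Qed.

Lemma bernoulli_mean_near n u F (c : K) (d : R) : (forall i, 0 <= u i <= 1) ->
  (forall x, modulus (c - F x) <= d) ->
  modulus (c - bernoulli_mean n u F) <= d.
Proof.
elim: n u F => [|n IH] u F u01 cF //=; apply: convex_near => //.
  by apply: IH => [i|x]; [exact: u01|exact: cF].
by apply: IH => [i|x]; [exact: u01|exact: cF].
Qed.

(** Both means treat the first [n] coordinates alike, and the others change [F] by at most [d]. The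
    induction conditions on the first coordinate; at n = 0 all values of [F] are within [d] of each
    other. *)
Lemma bernoulli_mean_cauchy n m u F (d : R) : (forall i, 0 <= u i <= 1) ->
  (n <= m)%N ->
  (forall x y, (forall i, (i < n)%N -> x i = y i) ->
    modulus (F x - F y) <= d) ->
  modulus (bernoulli_mean n u F - bernoulli_mean m u F) <= d.
Proof.
elim: n m u F => [|n IH] m u F u01 nm dF.
  by apply: bernoulli_mean_near => // x; exact: dF.
case: m nm => // m; rewrite ltnS => nm /=.
have dFs b : modulus (bernoulli_mean n (u \o S) (F \o shift b) -
    bernoulli_mean m (u \o S) (F \o shift b)) <= d.
  apply: IH => // [i|x y xy]; first exact: u01.
  by apply: dF => -[|i]//= /xy.
have /andP[p0 p1] := u01 0%N.
rewrite opprD addrACA -!mulrBr (le_trans (modulusD _ _))// !modulusM.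
rewrite !ofRealK ?subr_ge0//; rewrite -subr_ge0 in p1.
by have := dFs false; have := dFs true; nra.
Qed.

(** With parameters 0 and 1 the product measure is a point mass. *)
Lemma bernoulli_mean_vertex n u F x :
  (forall i, (i < n)%N -> u i = (x i)%:R) ->
  bernoulli_mean n u F = F (fun i => if (i < n)%N then x i else false).
Proof.
elim: n u F x => [|n IH] u F x ux //=.
have Fx : F (fun i => if (i < n.+1)%N then x i else false) =
    bernoulli_mean n (u \o S) (F \o shift (x 0%N)).
  rewrite (IH _ _ (x \o S)) => [/=|i ilt]; last exact: ux.
  by congr F; apply/funext => -[|i].
rewrite Fx ux//; case: (x 0%N).
  by rewrite subrr ofReal0 ofReal1 mul0r mul1r add0r.
by rewrite subr0 ofReal0 ofReal1 mul0r mul1r addr0.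
Qed.

Lemma bernoulli_mean_continuous {T : topologicalType} n (u : nat -> T -> R) F :
  (forall i, continuous (u i)) ->
  continuous (fun t => bernoulli_mean n (u^~ t) F).
Proof.
elim: n u F => [|n IH] u F cu t /=; first exact: cvg_cst.
have cu' i : continuous ((u \o S) i) by exact: (cu i.+1).
apply: (@cvgD K K); apply: (@cvgM K).
- apply: (continuous_comp (f := fun t => 1 - u 0%N t)).
    by apply: cvgB; [exact: cvg_cst|exact: cu].
  exact: ofReal_continuous.
- exact: IH cu' t.
- apply: (continuous_comp (f := u 0%N)); first exact: cu.
  exact: ofReal_continuous.
- exact: IH cu' t.
Qed.

Lemma cylinder_nbhs (x : cantor_space) n :
  \forall y \near x, forall i, (i < n)%N -> x i = y i.
Proof.
elim: n => [|n IH].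
  by apply: (@filterS _ (nbhs x) _ setT) => //; exact: filterT.
have : nbhs x (@proj nat (fun=> bool) n @^-1` [set x n]).
  exact/(@proj_continuous nat (fun=> bool) n x)/discrete_set1.
apply: filterS2 IH => y xy /= yx i.
by rewrite ltnS leq_eqVlt => /predU1P[->|/xy].
Qed.

Lemma cylinder_sequence_cvg (x : cantor_space) (y : nat -> cantor_space) :
  (forall n i, (i < n)%N -> x i = y n i) -> y @ \oo --> x.
Proof.
move=> xy; apply/cvg_sup => N U [V] [[W] oW <-] WfN WU.
apply: (filterS WU); rewrite nbhs_simpl; exists N.+1 => // i /= Ni.
by rewrite -(xy _ _ Ni).
Qed.

(** Uniform continuity read off coordinates: each [x] has a cylinder on which [F] stays within
    [d / 2] of [F x], and compactness gives one length for all points. *)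
Lemma cantor_unif_continuous (F : cantor_space -> K) (d : R) : continuous F ->
  0 < d -> exists n, forall x y, (forall i, (i < n)%N -> x i = y i) ->
    modulus (F x - F y) <= d.
Proof.
move=> cF d0; pose P n (x : cantor_space) := forall y : cantor_space,
  (forall i, (i < n)%N -> x i = y i) -> modulus (F x - F y) <= d.
suff [n _ nP] : \forall n \near \oo, [set: cantor_space] `<=` P n.
  by exists n => x y; exact: (nP n (leqnn n) x I y).
apply: ((iffLR (compact_near_coveringP _)) cantor_space_compact) => x _.
have [n nP] : exists n, forall y : cantor_space,
    (forall i, (i < n)%N -> x i = y i) -> modulus (F x - F y) <= d / 2.
  apply: contrapT => /forallNP nx.
  have yP n : exists y : cantor_space,
      (forall i, (i < n)%N -> x i = y i) /\ ~ modulus (F x - F y) <= d / 2.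
    by have /existsNP[y /not_implyP] := nx n; exists y.
  have [y xy] := choice yP.
  have : F \o y @ \oo --> F x.
    apply: (@cvg_comp _ _ _ y F \oo (nbhs x)); last exact: cF.
    by apply: cylinder_sequence_cvg => n; have [] := xy n.
  move/cvg_modulusP => /(_ (d / 2)); rewrite divr_gt0// => /(_ isT)[N _ yN].
  by have [_] := xy N; apply; rewrite ltW// yN/=.
exists ([set y | forall i, (i < n)%N -> x i = y i], [set m | (n <= m)%N]).
  by split; [exact: cylinder_nbhs|exists n].
move=> [y m] /= [xy nm] z yz.
rewrite (le_trans (modulus_dist_triangle (F x) _ _))// [leRHS]splitr lerD//.
  by rewrite modulus_subC nP.
by apply: nP => i ilt; rewrite xy// yz// (leq_trans ilt).
Qed.
End bernoulli_mean.

(** * Independent functions on a space without isolated points *)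

Section independent_functions.
Context {R : realType} {S : metricType R} (perfS : isolated [set: S] = set0).

Lemma finite_set_closed (F : set S) : finite_set F -> closed F.
Proof.
have /accessible_finite_set_closed : accessible_space S.
  exact/hausdorff_accessible/metric_hausdorff.
exact.
Qed.

(** If [U] were contained in [F], removing the closed set [F \ x] from [U] would leave {x} open,
    making [x] isolated. *)
Lemma perfect_open_setDfinite (U F : set S) : open U -> U !=set0 ->
  finite_set F -> exists2 x, U x & ~ F x.
Proof.
move=> oU [x Ux] fF; apply: contrapT => UF.
have {}UF : U `<=` F.
  by move=> y Uy; apply: contrapT => Fy; apply: UF; exists y.
suff : isolated [set: S] x by rewrite perfS.
split; first by rewrite inE.
exists (U `&` ~` (F `\ x)).
  apply: filterI; first exact: open_nbhs_nbhs.
  apply: open_nbhs_nbhs; split; last by case=> _ /(_ erefl).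
  apply: closed_openC.
  by apply: finite_set_closed; exact: finite_setD.
rewrite setIT; apply/seteqP; split=> [y [Uy Fy]|_ ->].
  by apply: contrapT => yx; apply: Fy; split => //; exact: UF.
by split => // -[_ /(_ erefl)].
Qed.

(** Greedy choice: each member of [G] receives two new points, distinct from the finitely many
    chosen before. *)
Lemma disjoint_finite_hitting_sets (G : seq (set S)) :
  (forall U, U \in G -> open U /\ U !=set0) ->
  exists A B, [/\ finite_set A, finite_set B, A `&` B = set0 &
    forall U, U \in G -> (U `&` A !=set0) /\ (U `&` B !=set0)].
Proof.
elim: G => [|U G IH] Gop; first by exists set0, set0; rewrite set0I.
have [|A [B [fA fB AB0 GAB]]] := IH.
  by move=> V VG; apply: Gop; rewrite inE VG orbT.
have [oU U0] := Gop U (mem_head _ _).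
have [x Ux /not_orP[xA xB]] : exists2 x, U x & ~ (A `|` B) x.
  by apply: perfect_open_setDfinite => //; rewrite finite_setU.
have [y Uy /not_orP[/not_orP[yA yB] yx]] :
    exists2 y, U y & ~ (A `|` B `|` [set x]) y.
  by apply: perfect_open_setDfinite => //; rewrite !finite_setU.
exists (x |` A), (y |` B); split; rewrite ?finite_setU//.
  apply/seteqP; split => // z [[->|Az] [zy|Bz]] //.
  - by apply: yx; rewrite zy.
  - by apply: yA; rewrite -zy.
  - by rewrite -AB0.
move=> V; rewrite inE => /predU1P[->|/GAB]; last first.
  move=> [[a [Va Aa]] [b [Vb Bb]]].
  by split; [exists a|exists b]; split => //; right.
by split; [exists x|exists y]; split => //; left.
Qed.

(** Both values are taken on sets with nonempty interior in each member of [G], so that the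
    construction can be repeated inside those interiors. *)
Lemma separating_function (G : seq (set S)) :
  (forall U, U \in G -> open U /\ U !=set0) ->
  exists u : S -> R, [/\ continuous u, forall t, 0 <= u t <= 1 &
    forall U (b : bool), U \in G -> (U `&` [set t | u t = b%:R])^° !=set0].
Proof.
move=> Gop; have [A [B [fA fB AB0 GAB]]] := disjoint_finite_hitting_sets Gop.
have sepAB : uniform_separator A B.
  apply: (iffLR (@normal_separatorP R _)) => //.
  - exact: pseudometric_normal.
  - exact: finite_set_closed.
  - exact: finite_set_closed.
pose v : S -> R := Urysohn A B.
have cv : continuous v := @Urysohn_continuous _ _ A B.
have vA t : A t -> v t = 0 by move=> At; apply: (Urysohn_sub0 sepAB); exists t.
have vB t : B t -> v t = 1 by move=> Bt; apply: (Urysohn_sub1 sepAB); exists t.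
(* Clamping 3 v - 1 flattens the Urysohn function: 0 where v <= 1/3, around [A], and 1 where v >=
   2/3, around [B]. *)
have cr : continuous (fun t => 3 * v t - 1).
  move=> t; apply: cvgB; last exact: cvg_cst.
  by apply: cvgM; [exact: cvg_cst|exact: cv].
exists (clamp \o (fun t => 3 * v t - 1)); split.
- exact: clamp_continuous.
- by move=> t; rewrite /= clamp_ge0 clamp_le1.
move=> U b UG; have [[a [Ua Aa]] [c [Uc Bc]]] := GAB _ UG.
have [oU _] := Gop _ UG.
case: b.
  exists c; apply: filterI; first exact: open_nbhs_nbhs.
  have : \forall t \near c, 2 / 3 < v t.
    apply: (cvgr_gt (v c)) (cv c) _ _.
    by rewrite vB// ltr_pdivrMr// mul1r ltr_nat.
  by apply: filterS => t vt; rewrite /= clamp_eq1//; lra.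
exists a; apply: filterI; first exact: open_nbhs_nbhs.
have : \forall t \near a, v t < 1 / 3.
  by apply: (cvgr_lt (v a)) (cv a) _ _; rewrite vA// divr_gt0.
by apply: filterS => t vt; rewrite /= clamp_eq0//; lra.
Qed.

(** The functions are built one at a time along with a finite family of nonempty open sets, one for
    each 0-1 pattern of the functions so far; the next function splits every member in two. *)
Lemma independent_functions (W : set S) : open W -> W !=set0 ->
  exists u : nat -> S -> R, [/\ forall i, continuous (u i),
    forall i t, 0 <= u i t <= 1 &
    forall n (x : nat -> bool), exists2 t, W t &
      forall i, (i < n)%N -> u i t = (x i)%:R].
Proof.
move=> oW W0.
pose state := {G : seq (set S) | forall U, U \in G -> open U /\ U !=set0}.
have step (G : state) : exists uG : (S -> R) * state, [/\ continuous uG.1,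
    forall t, 0 <= uG.1 t <= 1 &
    forall U (b : bool), U \in sval G -> exists2 V, V \in sval uG.2 &
      V `<=` U `&` [set t | uG.1 t = b%:R]].
  have [u [cu u01 uG]] := separating_function (svalP G).
  pose part (b : bool) U := (U `&` [set t | u t = b%:R])^°.
  pose G' := map (part false) (sval G) ++ map (part true) (sval G).
  have G'op U : U \in G' -> open U /\ U !=set0.
    rewrite mem_cat => /orP[] /mapP[V VG ->];
      by split; [exact: open_interior|exact: uG].
  exists (u, exist _ G' G'op); split => //= U b UG.
  exists (part b U); last exact: interior_subset.
  by rewrite mem_cat; case: b; rewrite map_f ?orbT.
have [f fP] := choice step.
have W1 : forall U, U \in [:: W] -> open U /\ U !=set0.
  by move=> U; rewrite inE => /eqP ->.
pose G n : state := iter n (fun H => (f H).2) (exist _ [:: W] W1).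
exists (fun n => (f (G n)).1); split.
- by move=> i; have [] := fP (G i).
- by move=> i; have [] := fP (G i).
move=> n x.
have [U UG UW] : exists2 U, U \in sval (G n) & U `<=` W `&`
    [set t | forall i, (i < n)%N -> (f (G i)).1 t = (x i)%:R].
  elim: n => [|n [U UG UW]]; first by exists W; [exact: mem_head|move=> t Wt].
  have [_ _ /(_ U (x n) UG)[V VG VU]] := fP (G n).
  exists V => // t /VU[/UW[Wt tx] tn]; split => // i.
  by rewrite ltnS leq_eqVlt => /predU1P[->|/tx].
have [_ [t /UW[Wt tx]]] := svalP (G n) _ UG.
by exists t.
Qed.
End independent_functions.

(** * The embedding of C(S) *)

Section embedding.
Context {R : realType} {S : metricType R} {cS : compact [set: S]}
  {k : scalars} (perfS : isolated [set: S] = set0).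
Local Notation K := (scalarField R k).
Local Notation X := (contSpace R cS k).

(** The Hausdorff-Alexandroff theorem; [s0] serves as base point. *)
Lemma cantor_surjection (s0 : S) : exists phi : cantor_space -> S,
  continuous phi /\ forall s, exists x, phi x = s.
Proof.
pose S' : pseudoPMetricType R := HB.pack S (isPointed.Build S s0).
have [phi cphi] := @cantor_surj R S' cS (metric_hausdorff (T := S)).
exists phi; split => // s.
by have [x _ xs] := @surj _ _ _ _ phi s I; exists x.
Qed.

(** [J f] is a cutoff [w] times the integral [L f] of [f \o phi]. Averaging does not increase the
    norm. Conversely, for s = phi y, some [t] with w t = 1 has parameters agreeing with [y] on a
    long prefix, and there [L f t] is close to [f s]. *)
Lemma localized_isometry (s0 : S) (W : set S) : open W -> W !=set0 ->
  exists J : {linear X -> X}, (forall f s, ~ W s -> csval (J f) s = 0) /\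
    forall f, supNorm (J f) = supNorm f.
Proof.
move=> oW [t0 Wt0].
have sep : uniform_separator [set t0] (~` W).
  exact: point_uniform_separator (open_closedC oW) (fun nWt0 => nWt0 Wt0).
pose v : S -> R := Urysohn [set t0] (~` W).
have cv : continuous v := @Urysohn_continuous _ _ _ _.
have v0 : v t0 = 0 by apply: (Urysohn_sub0 sep); exists t0.
have v1 t : ~ W t -> v t = 1 by move=> Wt; apply: (Urysohn_sub1 sep); exists t.
(* Clamped, this is 1 where v <= 1/3, in particular on the set [V] below, and 0 off [W], where v =
   1. *)
have cr : continuous (fun t => 2 - 3 * v t).
  move=> t; apply: cvgB; first exact: cvg_cst.
  by apply: cvgM; [exact: cvg_cst|exact: cv].
pose w : X := csR (clamp_continuous cr).
have w01 : unitval w.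
  by apply: unitval_csR => t; rewrite /= clamp_ge0 clamp_le1.
pose V := [set t | v t < 1 / 3].
have oV : open V.
  apply: (@open_comp _ _ v [set y | y < 1 / 3]); last exact: open_lt.
  by move=> t _; exact: cv.
have [|u [cu u01 uV]] := independent_functions perfS oV.
  by exists t0; rewrite /V /= v0 divr_gt0.
have [phi [cphi phis]] := cantor_surjection s0.
pose x n (f : X) : X :=
  mkcs (@bernoulli_mean_continuous R k S n u (csval f \o phi) cu).
have cfphi (f : X) : continuous (csval f \o phi).
  move=> y; apply: (continuous_comp (f := phi)); first exact: cphi.
  exact: cs_continuous.
have x_linear n (a : K) f g : x n (a *: f + g) = a *: x n f + x n g.
  by apply: csP => t; rewrite csDE csZE -bernoulli_mean_linear.
have x_cauchy f e : 0 < e -> exists N, forall m n, (N <= m)%N -> (N <= n)%N ->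
    supNorm (x m f - x n f) <= e.
  move=> e0; have e20 : 0 < e / 2 by rewrite divr_gt0.
  have [N fN] := cantor_unif_continuous (cfphi f) e20.
  have xN m : (N <= m)%N -> supNorm (x N f - x m f) <= e / 2.
    move=> Nm; apply: supNorm_le => [|t]; first exact: ltW.
    by rewrite csBE; apply: bernoulli_mean_cauchy.
  exists N => m n Nm Nn; have -> : x m f - x n f =
      - (x N f - x m f) + (x N f - x n f) by rewrite opprB addrA subrK.
  by rewrite (le_trans (supNormD _ _))// supNormN [leRHS]splitr lerD// xN.
have [L xL] := choice (fun f => contSpace_complete (x_cauchy f)).
have L_linear : linear L.
  move=> a f g; apply/eqP; rewrite -subr_eq0; apply/eqP/supNorm0_eq0.
  apply/eqP; rewrite eq_le supNorm_ge0 andbT; apply/ler_addgt0Pr => e e0.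
  (* [L] comes from a choice of limits, so linearity is recovered from the approximants: the errors
     are [d], |a| d and [d]. *)
  rewrite add0r; pose d := e / (2 + modulus a).
  have a2 : 0 < 2 + modulus a by rewrite ltr_wpDr ?modulus_ge0.
  have d0 : 0 < d by rewrite divr_gt0.
  have [N1 L1] := xL (a *: f + g) d d0.
  have [N2 L2] := xL f d d0; have [N3 L3] := xL g d d0.
  pose n := maxn N1 (maxn N2 N3).
  have n1 : (N1 <= n)%N by rewrite leq_maxl.
  have n2 : (N2 <= n)%N by rewrite !leq_max leqnn orbT.
  have n3 : (N3 <= n)%N by rewrite !leq_max leqnn !orbT.
  have -> : L (a *: f + g) - (a *: L f + L g) = (L (a *: f + g) -
      x n (a *: f + g)) - (a *: (L f - x n f) + (L g - x n g)).
    by rewrite x_linear scalerBr addrACA -opprD opprB addrA subrK.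
  rewrite (le_trans (supNormD _ _))// supNormN.
  have h1 := L1 n n1.
  have h2 := supNormD (a *: (L f - x n f)) (L g - x n g).
  rewrite supNormZ in h2.
  have h3 := ler_wpM2l (modulus_ge0 a) (L2 n n2); have h4 := L3 n n3.
  have -> : e = d + (modulus a * d + d) by rewrite /d; field; rewrite gt_eqF.
  by lra.
have J_linear : linear (csM w \o L).
  by move=> a f g; rewrite /= L_linear csM_linear.
pose J : {linear X -> X} :=
  HB.pack (csM w \o L) (GRing.isLinear.Build _ _ _ _ _ J_linear).
exists J; split.
  by move=> f s Ws; rewrite csME csRE /= v1// clamp_eq0 ?ofReal0 ?mul0r.
move=> f; apply/eqP; rewrite eq_le; apply/andP; split.
  apply: supNorm_le => [|t]; first exact: supNorm_ge0.
  rewrite csME modulusM (le_trans (ler_piMl (modulus_ge0 _) (w01 t).2))//.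
  apply/ler_addgt0Pr => e e0; have [N LN] := xL f e e0.
  have := le_trans (modulus_le_supNorm (L f - x N f) t) (LN N (leqnn N)).
  have : modulus (0 - csval (x N f) t) <= supNorm f.
    apply: bernoulli_mean_near => // y.
    by rewrite sub0r modulusN modulus_le_supNorm.
  rewrite csBE => h1 h2.
  have := modulusD (csval (L f) t - csval (x N f) t) (csval (x N f) t).
  by rewrite subrK; rewrite sub0r modulusN in h1; move=> *; lra.
apply: supNorm_le => [|s]; first exact: supNorm_ge0.
apply/ler_addgt0Pr => e e0; have e20 : 0 < e / 2 by rewrite divr_gt0.
have [y ys] := phis s.
have [N1 L1] := xL f _ e20.
have [N2 f2] := cantor_unif_continuous (cfphi f) e20.
(* [N1] brings [x n f] close to [L f]; [N2] lets [y] be truncated after [n] coordinates. *)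
pose n := maxn N1 N2.
have [t Vt ut] := uV n y.
have wt : csval w t = 1.
  rewrite csRE /= clamp_eq1 ?ofReal1//.
  by move: Vt; rewrite /V /= => Vt; lra.
have h1 := le_trans (modulus_le_supNorm _ t) (L1 n (leq_maxl _ _)).
have h2 : modulus (csval f s - csval (x n f) t) <= e / 2.
  have -> : csval (x n f) t =
      csval f (phi (fun i => if (i < n)%N then y i else false)).
    exact: bernoulli_mean_vertex.
  rewrite -ys; apply: f2 => i iN; rewrite ifT// (leq_trans iN)//.
  exact: leq_maxr.
have h3 : modulus (csval (L f) t) <= supNorm (J f).
  rewrite (le_trans _ (modulus_le_supNorm _ t))// csME.
  by rewrite wt mul1r.
have := modulus_dist_triangle (csval (x n f) t) (csval f s) (csval (L f) t).
have := modulusD (csval f s - csval (L f) t) (csval (L f) t).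
rewrite subrK; rewrite csBE modulus_subC in h1 => h4 h5.
by rewrite [e]splitr; lra.
Qed.
End embedding.

(** * The operator norm and the Daugavet equation *)

Section opNorm.
Context {R : realType} {S : topologicalType} {cS : compact [set: S]}
  {k : scalars}.
Local Notation K := (scalarField R k).
Local Notation X := (contSpace R cS k).
Context (T : X -> X) (C : R)
  (TC : forall f, supNorm f <= 1 -> supNorm (T f) <= C).

Let image := [set modulus `|T f| | f in [set f : X | `|f| <= 1]].

Let imageP (x : R) :
  image x <-> exists2 f, supNorm f <= 1 & supNorm (T f) = x.
Proof.
split=> [[f]|[f]].
  rewrite /= -ofReal1 norm_le_supNorm cs_normE ofRealK ?supNorm_ge0//.
  by move=> *; exists f.
move=> f1 fx; exists f; rewrite /= ?cs_normE ?ofRealK ?supNorm_ge0//.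
by rewrite -ofReal1 ler_ofReal.
Qed.

Let has_sup_image : has_sup image.
Proof.
split; last by exists C => _ /imageP[f f1 <-]; exact: TC.
by exists (supNorm (T 0)); apply/imageP; exists 0; rewrite ?supNorm0.
Qed.

Lemma le_opNorm f : supNorm f <= 1 -> supNorm (T f) <= opNorm T.
Proof.
move=> f1; apply: ub_le_sup; first by case: has_sup_image.
by apply/imageP; exists f.
Qed.

Lemma opNorm_adherent e : 0 < e ->
  exists2 f, supNorm f <= 1 & opNorm T - e < supNorm (T f).
Proof.
by move=> /sup_adherent/(_ has_sup_image)[_ /imageP[f f1 <-]]; exists f.
Qed.

Lemma opNorm_le (D : R) : (forall f, supNorm f <= 1 -> supNorm (T f) <= D) ->
  opNorm T <= D.
Proof.
move=> TD; apply: ge_sup; first by case: has_sup_image.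
by move=> _ /imageP[f f1 <-]; exact: TD.
Qed.
End opNorm.

Theorem theorem1p1 (R : realType) (k : scalars)
    (S : metricType R) (cS : compact [set: S])
    (perfS : isolated [set: S] = set0)
    (T : {linear contSpace R cS k -> contSpace R cS k})
    (bT : bounded_near T (nbhs (0 : contSpace R cS k))) :
  ~ fixesCopy (contSpace R cS k) T ->
  opNorm (idfun \+ T) = 1 + opNorm T.
Proof.
move=> noCopy.
have [C TC] : exists C, forall f, supNorm (T f) <= C * supNorm f.
  have /linear_boundedP/pinfty_ex_gt0[r r0 Tr] := bT.
  exists (modulus r) => f; rewrite -(@ler_ofReal R k) ofRealM -!cs_normE -normE.
  by rewrite (gtr0_norm r0).
have T1 (f : contSpace R cS k) : supNorm f <= 1 -> supNorm (T f) <= `|C|.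
  move=> f1; rewrite (le_trans (TC f))//.
  rewrite (le_trans (ler_wpM2r (supNorm_ge0 _) (ler_norm _)))//.
  by rewrite ler_piMr.
have IT1 (f : contSpace R cS k) :
    supNorm f <= 1 -> supNorm ((idfun \+ T) f) <= 1 + opNorm T.
  move=> f1; rewrite (le_trans (supNormD _ _))// lerD//.
  exact: le_opNorm T1 _ f1.
apply/eqP; rewrite eq_le (opNorm_le IT1 IT1)/= leNgt; apply/negP => lt_norm.
apply: noCopy.
(* If [S] is empty, C(S) is zero and the identity embedding is a fixed copy. *)
have [[s0 _]|noS] := pselect (exists s : S, True); last first.
  apply: (fixesCopy_of_lower_bound (J := idfun) (C := 1) (c := 1)) TC _ _ => //.
    by move=> f; rewrite mul1r.
  move=> f; rewrite mul1r.
  suff -> : f = 0 by rewrite linear0.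
  by apply: csP => s; case: noS; exists s.
pose e := 1 + opNorm T - opNorm (idfun \+ T).
have e0 : 0 < e by rewrite subr_gt0.
have gap (f : contSpace R cS k) :
    supNorm f <= 1 -> supNorm (f + T f) <= 1 + opNorm T - e.
  by move=> f1; rewrite /e opprB [leRHS]addrC subrK; exact: le_opNorm IT1 _ f1.
have [q [W [q2 oW W0 qW]]] := local_lower_bound e0 (le_opNorm T1)
  (opNorm_adherent T1) gap s0.
have [J [JW JE]] := localized_isometry (cS := cS) (k := k) perfS s0 oW W0.
(* The copy is embedded by f |-> q J f: [J f] vanishes off [W] and has the norm of [f], so the local
   lower bound applies with constant [e / 2]. *)
have qJ_linear : linear (csM q \o J).
  by move=> a f g; rewrite /= linearP csM_linear.
pose qJ : {linear contSpace R cS k -> contSpace R cS k} :=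
  HB.pack (csM q \o J) (GRing.isLinear.Build _ _ _ _ _ qJ_linear).
apply: (fixesCopy_of_lower_bound (J := qJ) (C := supNorm q) (c := e / 2))
  TC _ _.
- by move=> f; rewrite -(JE f) supNormM.
- by rewrite divr_gt0.
- by move=> f; rewrite -(JE f) qW//; exact: JW.
Qed.
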